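(* Let $n\ge1$, let $U=\{\theta=(\theta_1,\dots,\theta_n)\in\mathbb{R}^n:\theta_i>0,\ i=1,\dots,n+1\}$ where $\theta_{n+1}=1-\sum_{i=1}^n\theta_i$, and for $\theta\in U$ let $J(\theta)$ be the $n\times n$ matrix with entries $J_{ij}(\theta)=\frac{1}{\theta_{n+1}}+\frac{\delta_{ij}}{\theta_j}$. Then every $J$-geodesic $t\mapsto\boldsymbol\theta(t)=(\theta_1(t),\dots,\theta_n(t))$ in $U$ is a solution of the second order decoupled system $$2\theta_k\frac{d^2\theta_k}{dt^2}+\theta_k^2-\left(\frac{d\theta_k}{dt}\right)^2=0,\qquad k=1,2,\dots,n.$$
   Context: $U$ carries the Riemannian metric $\langle v,w\rangle_{J(\theta)}=v^TJ(\theta)w$, $v,w\in\mathbb{R}^n$. Write $J=(g_{ij})$, $J^{-1}=(g^{ij})$, $g_{jl,i}=\partial g_{jl}/\partial\theta_i$, $\Gamma_{ijl}=\frac12(g_{jl,i}+g_{li,j}-g_{ij,l})$ and $\Gamma_{ij}^k=\sum_{l=1}^n\Gamma_{ijl}g^{lk}$. A $J$-geodesic is a smooth curve $\boldsymbol\theta$ in $U$, defined on an interval, that has unit speed, $\langle\dot{\boldsymbol\theta}(t),\dot{\boldsymbol\theta}(t)\rangle_{J(\boldsymbol\theta(t))}=1$ for all $t$, and satisfies the geodesic system $\ddot\theta_k+\sum_{i=1}^n\sum_{j=1}^n\Gamma_{ij}^k(\boldsymbol\theta)\dot\theta_i\dot\theta_j=0$, $k=1,\dots,n$. *)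

(* Defs.v *)
From HB Require Import structures.
From mathcomp Require Import all_boot all_order all_algebra.
From mathcomp Require Import boolp classical_sets set_interval reals.
From mathcomp Require Import topology normedtype derive.

Set Implicit Arguments.
Unset Strict Implicit.
Unset Printing Implicit Defensive.

Import Order.TTheory GRing.Theory Num.Theory.
Import numFieldNormedType.Exports.

Local Open Scope classical_set_scope.
Local Open Scope ring_scope.

Section RiemannianMetric.
Variables (R : realType) (n : nat).

Implicit Types (U : set 'cV[R]_n) (J : 'cV[R]_n -> 'M[R]_n).

Definition metric J (theta v w : 'cV[R]_n) : R :=
  (v^T *m J theta *m w) ord0 ord0.

(* g_{jl,i}: the last index is the one of differentiation. *)
Definition metric_partial J (j l i : 'I_n) (theta : 'cV[R]_n) : R :=
  'D_(delta_mx i ord0) (fun x : 'cV[R]_n => J x j l) theta.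

(* Christoffel symbols of the first kind Gamma_{ijl}, then of the second kind
   Gamma_{ij}^k. *)
Definition christoffel1 J (i j l : 'I_n) (theta : 'cV[R]_n) : R :=
  2^-1 * (metric_partial J j l i theta + metric_partial J l i j theta
          - metric_partial J i j l theta).

Definition christoffel2 J (i j k : 'I_n) (theta : 'cV[R]_n) : R :=
  \sum_(l < n) christoffel1 J i j l theta * invmx (J theta) l k.

Definition coord_fun (c : R -> 'cV[R]_n) (k : 'I_n) : R -> R :=
  fun t => c t k ord0.

Definition velocity (c : R -> 'cV[R]_n) (t : R) : 'cV[R]_n :=
  \col_k derive1 (coord_fun c k) t.

(* A curve on an arbitrary, not necessarily open, interval I is smooth when it
   is the restriction of a map that is C^oo on an open set containing I. Here c
   is such a map; if I is open, only the values of c on I matter. At an endpoint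
   t in I the two-sided derivatives of c at t are the one-sided ones of c|I. *)
Definition smooth_on (I : set R) (c : R -> 'cV[R]_n) : Prop :=
  exists V : set R, [/\ open V, I `<=` V &
    forall (k : 'I_n) (m : nat) (t : R), V t ->
      derivable (derive1n m (coord_fun c k)) t 1].

Definition is_geodesic U J (I : set R) (c : R -> 'cV[R]_n) : Prop :=
  [/\ is_interval I,
      smooth_on I c,
      (forall t, I t -> U (c t)),
      (forall t, I t -> metric J (c t) (velocity c t) (velocity c t) = 1) &
      (forall t, I t -> forall k : 'I_n,
         derive1n 2 (coord_fun c k) t
         + \sum_(i < n) \sum_(j < n)
             christoffel2 J i j k (c t)
             * derive1 (coord_fun c i) t * derive1 (coord_fun c j) t = 0)].

End RiemannianMetric.

Section Simplex.
Variables (R : realType) (n : nat).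

(* theta_{n+1} *)
Definition last_coord (theta : 'cV[R]_n) : R := 1 - \sum_(i < n) theta i ord0.

Definition open_simplex : set 'cV[R]_n :=
  [set theta : 'cV[R]_n | (forall i : 'I_n, 0 < theta i ord0) /\ 0 < last_coord theta].

Definition simplex_metric (theta : 'cV[R]_n) : 'M[R]_n :=
  \matrix_(i < n, j < n)
    (1 / last_coord theta + (i == j)%:R / theta j ord0).

End Simplex.

Arguments open_simplex : clear implicits.
Arguments simplex_metric {R n} theta.

(* Main.v *)
Require Import Defs.
From HB Require Import structures.
From mathcomp Require Import all_boot all_order all_algebra.
From mathcomp Require Import boolp classical_sets functions set_interval reals.
From mathcomp Require Import topology normedtype derive.
From mathcomp Require Import ring.

Set Implicit Arguments.
Unset Strict Implicit.
Unset Printing Implicit Defensive.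

Import Order.TTheory GRing.Theory Num.Theory.
Import numFieldNormedType.Exports.

Local Open Scope classical_set_scope.
Local Open Scope ring_scope.

(** The identity holds at each time separately: it is the geodesic system with
    the Christoffel symbols computed and the unit speed substituted.

    Write L for theta_{n+1}. Differentiating 1/L + delta_jl/theta_l along
    theta_i gives 1/L^2 - delta_ij delta_il/theta_l^2, which is symmetric in all
    three indices: J is the Hessian of a function, the negative entropy. Hence
    two of the three terms of Gamma_{ijl} cancel, and Gamma_{ijl} is half of this
    partial derivative ([christoffel1E]). Contracting it with a velocity v, and
    writing S for the sum of the v_i, yields
      sum_ij Gamma_{ijl} v_i v_j = (S^2/L^2 - v_l^2/theta_l^2) / 2.
    The inverse of J is diag(theta) - theta theta^T, a rank-one correction of a
    diagonal matrix ([invmx_simplex_metric]). Raising the index with it turns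
    the terms common to all l into S^2/L + sum_i v_i^2/theta_i, which is exactly
    the squared speed <v,v>_J, and so
      sum_ij Gamma_{ij}^k v_i v_j = (theta_k <v,v>_J - v_k^2/theta_k) / 2
    ([christoffel2_contract]). All coupling between the coordinates sits in the
    squared speed, so unit speed decouples the system: what remains is
    theta_k'' + (theta_k - theta_k'^2/theta_k) / 2 = 0, to be multiplied by
    2 theta_k. *)

Lemma sum_delta_l (R : pzSemiRingType) (I : finType) (i : I) (F : I -> R) :
  \sum_j (i == j)%:R * F j = F i.
Proof.
rewrite (bigD1 i) //= eqxx mul1r big1 ?addr0 // => j /negbTE ij.
by rewrite eq_sym ij mul0r.
Qed.

(** The derivative of the identity of the space of columns, read entrywise. *)
Lemma is_derive_coord (R : realType) (n : nat) (k : 'I_n) (theta v : 'cV[R]_n) :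
  is_derive theta v (fun x : 'cV[R]_n => x k ord0) (v k ord0).
Proof.
have idP := @derivable_id R 'cV[R]_n theta v.
split; first exact: (derivable_mxP _ _ _).1 idP k ord0.
by have /matrixP/(_ k ord0) := derive_mx idP; rewrite derive_id mxE.
Qed.

Lemma is_derive_last_coord (R : realType) (n : nat) (i : 'I_n)
    (theta : 'cV[R]_n) :
  is_derive theta (delta_mx i ord0) (@last_coord R n) (- 1).
Proof.
have -> : @last_coord R n =
    cst 1 - \sum_(k < n) (fun x : 'cV[R]_n => x k ord0).
  by apply/funext => x; rewrite /last_coord !fctE fct_sumE.
have dsum := is_derive_sum (fun k => is_derive_coord k theta (delta_mx i ord0)).
apply: is_derive_eq (is_deriveB (is_derive_cst _ _ _) dsum) _.
rewrite sub0r; congr (- _).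
rewrite -[RHS](sum_delta_l i (fun=> 1)).
by apply: eq_bigr => k _; rewrite mxE eqxx andbT mulr1 eq_sym.
Qed.

Section SimplexMetric.
Variables (R : realType) (n : nat) (theta : 'cV[R]_n).
Hypothesis theta_in : open_simplex R n theta.

Let coord_neq0 k : theta k ord0 != 0.
Proof. by rewrite gt_eqF //; case: theta_in. Qed.

Let last_coord_neq0 : last_coord theta != 0.
Proof. by rewrite gt_eqF //; case: theta_in. Qed.

Let sum_coord : \sum_(k < n) theta k ord0 = 1 - last_coord theta.
Proof. by rewrite /last_coord opprB addrC subrK. Qed.

Lemma metric_partialE (j l i : 'I_n) :
  metric_partial simplex_metric j l i theta =
    (last_coord theta)^-2
    - (i == j)%:R * ((i == l)%:R * (theta l ord0)^-2).
Proof.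
have [dL DL] := is_derive_last_coord i theta.
have [dx Dx] := is_derive_coord l theta (delta_mx i ord0).
rewrite /metric_partial.
have -> : (fun x : 'cV[R]_n => simplex_metric x j l) =
    (fun x => (last_coord x)^-1) + (j == l)%:R \*: (fun x => (x l ord0)^-1).
  by apply/funext => x; rewrite mxE div1r.
rewrite deriveD; [|exact: derivableV|exact/derivableZ/derivableV].
rewrite deriveZ; last exact: derivableV.
rewrite !deriveV // DL Dx mxE eqxx andbT /GRing.scale /=.
rewrite [l == i]eq_sym.
have [<-|_] := eqVneq i l; first by rewrite eq_sym; ring.
by rewrite /=; ring.
Qed.

(** The partial derivatives of the metric are invariant under all permutations of
    the three indices, so one positive term cancels the negative one. *)
Lemma christoffel1E (i j l : 'I_n) :
  christoffel1 simplex_metric i j l theta =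
    2^-1 * metric_partial simplex_metric i j l theta.
Proof.
rewrite /christoffel1 !metric_partialE.
have [<-|ij] := eqVneq i j; have [<-|il] := eqVneq i l;
  rewrite ?eqxx ?(eq_sym l) ?(eq_sym j) ?(negbTE ij) ?(negbTE il) /=; ring.
Qed.

(** The inverse is the Sherman-Morrison formula for the rank-one perturbation
    diag(1/theta) + (1/L) 1 1^T; the normalising factor 1 + (sum of theta)/L
    equals 1/L because the coordinates sum to 1 - L. *)
Lemma invmx_simplex_metric :
  invmx (simplex_metric theta) =
    \matrix_(l, k) ((k == l)%:R * theta k ord0 - theta l ord0 * theta k ord0).
Proof.
set K := (RHS).
have JK : simplex_metric theta *m K = 1%:M.
  apply/matrixP => i k; rewrite !mxE.
  under eq_bigr => j _.
    rewrite !mxE.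
    rewrite (_ : _ * _ = (k == j)%:R * (theta k ord0 / last_coord theta)
      - theta j ord0 * (theta k ord0 / last_coord theta)
      + (i == j)%:R * ((k == j)%:R * theta k ord0 / theta j ord0 - theta k ord0));
      last by field; rewrite last_coord_neq0 coord_neq0.
    over.
  rewrite !big_split /= sumrN !sum_delta_l -mulr_suml sum_coord.
  by have [<-|_] := eqVneq k i; rewrite /=; field;
    rewrite ?last_coord_neq0 ?coord_neq0.
have [J_unit _] := mulmx1_unit JK.
by rewrite -[LHS]mulmx1 -JK mulKmx.
Qed.

Lemma metric_simplexE (v : 'cV[R]_n) :
  metric simplex_metric theta v v =
    (\sum_(i < n) v i ord0) ^+ 2 / last_coord theta
    + \sum_(i < n) v i ord0 ^+ 2 / theta i ord0.
Proof.
rewrite /metric mxE expr2 -mulrA mulr_suml -big_split /=.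
under eq_bigr => j _ do rewrite mxE mulr_suml.
rewrite exchange_big; apply: eq_bigr => i _ /=.
under eq_bigr => j _.
  rewrite !mxE (_ : _ * _ * _ = v i ord0 / last_coord theta * v j ord0
    + (i == j)%:R * (v i ord0 * v j ord0 / theta j ord0)); last by ring.
  over.
rewrite big_split /= sum_delta_l -mulr_sumr; ring.
Qed.

Lemma christoffel1_contract (v : 'cV[R]_n) (l : 'I_n) :
  \sum_(i < n) \sum_(j < n)
     christoffel1 simplex_metric i j l theta * v i ord0 * v j ord0 =
    2^-1 * ((\sum_(i < n) v i ord0) ^+ 2 / last_coord theta ^+ 2
            - v l ord0 ^+ 2 / theta l ord0 ^+ 2).
Proof.
under eq_bigr => i _.
  under eq_bigr => j _.
    rewrite christoffel1E metric_partialE.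
    rewrite (_ : _ * _ * _ =
      2^-1 * (last_coord theta)^-2 * v i ord0 * v j ord0
      - (l == i)%:R * ((l == j)%:R
          * (2^-1 * (theta l ord0)^-2 * v i ord0 * v j ord0))); last first.
      by have [<-|_] := eqVneq l j; rewrite /=; ring.
    over.
  rewrite sumrB -!mulr_sumr sum_delta_l; over.
rewrite sumrB -mulr_suml -mulr_sumr sum_delta_l; ring.
Qed.

(** The coordinates other than the k-th enter only through the squared speed: the
    covector of [christoffel1_contract] has the constant part S^2/(2 L^2), and
    theta_k (1 - sum of theta) times it is theta_k S^2/(2 L), one of the two parts
    of theta_k <v,v>_J / 2; the rank-one term of the inverse supplies the other. *)
Lemma christoffel2_contract (v : 'cV[R]_n) (k : 'I_n) :
  \sum_(i < n) \sum_(j < n)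
     christoffel2 simplex_metric i j k theta * v i ord0 * v j ord0 =
    2^-1 * (theta k ord0 * metric simplex_metric theta v v
            - v k ord0 ^+ 2 / theta k ord0).
Proof.
(* Since the inverse does not depend on i and j, contract before raising l. *)
transitivity (\sum_(l < n)
   (\sum_(i < n) \sum_(j < n)
      christoffel1 simplex_metric i j l theta * v i ord0 * v j ord0)
   * invmx (simplex_metric theta) l k).
  under eq_bigr => i _ do
    under eq_bigr => j _ do rewrite /christoffel2 !mulr_suml.
  under eq_bigr => i _ do rewrite exchange_big.
  rewrite exchange_big; apply: eq_bigr => l _.
  rewrite mulr_suml; apply: eq_bigr => i _.
  rewrite mulr_suml; apply: eq_bigr => j _; ring.
under eq_bigr => l _ do rewrite christoffel1_contract invmx_simplex_metric mxE.
set S := \sum_(i < n) v i ord0.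
(* The summand is separated into a diagonal term, one proportional to theta_l,
   and one proportional to v_l^2 / theta_l, each of which has a known sum. *)
transitivity (\sum_(l < n)
   ((k == l)%:R * (2^-1 * (S ^+ 2 / last_coord theta ^+ 2
       - v l ord0 ^+ 2 / theta l ord0 ^+ 2) * theta k ord0)
    - theta l ord0 * (2^-1 * (S ^+ 2 / last_coord theta ^+ 2) * theta k ord0)
    + v l ord0 ^+ 2 / theta l ord0 * (2^-1 * theta k ord0))).
  by apply: eq_bigr => l _; field; rewrite last_coord_neq0 coord_neq0.
rewrite !big_split /= sumrN sum_delta_l -!mulr_suml sum_coord metric_simplexE.
by rewrite -/S; field; rewrite last_coord_neq0 coord_neq0.
Qed.

End SimplexMetric.

Theorem theorem3p6 (R : realType) (n : nat) (hn : (1 <= n)%N)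
    (I : set R) (theta : R -> 'cV[R]_n)
    (hgeo : is_geodesic (open_simplex R n) simplex_metric I theta) :
  forall t : R, I t -> forall k : 'I_n,
    2 * coord_fun theta k t * derive1n 2 (coord_fun theta k) t
    + coord_fun theta k t ^+ 2 - derive1 (coord_fun theta k) t ^+ 2 = 0.
Proof.
move=> t It k; case: hgeo => _ _ in_simplex unit_speed geodesic_eq.
have theta_in := in_simplex t It.
have contract := christoffel2_contract theta_in (velocity theta t) k.
have acc := geodesic_eq t It k.
move: contract; rewrite unit_speed // mulr1.
under eq_bigr => i _ do under eq_bigr => j _ do rewrite !mxE.
rewrite mxE => contract; rewrite {}contract in acc.
have x_neq0 : coord_fun theta k t != 0.
  by have [x_gt0 _] := theta_in; exact: lt0r_neq0 (x_gt0 k).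
have -> : derive1n 2 (coord_fun theta k) t =
    - (2^-1 * (coord_fun theta k t
               - derive1 (coord_fun theta k) t ^+ 2 / coord_fun theta k t)).
  exact/eqP/(etrans (esym (addr_eq0 _ _)))/eqP.
by field.
Qed.
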